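(* Let $\alpha,\beta,\gamma\in\mathbb{C}$ and $x,y\in\mathbb{C}$ with $|x|<1$, $|y|<1$. (i) If $q^\gamma\notin\{1,q^{-1},q^{-2},\dots\}$, then $$\mathbf{\Phi}_{1}(q^{\alpha},q^{\beta};q^{\gamma};q,x,y)=\sum_{n=0}^{\infty}\frac{(q^{\alpha};q)_{n}(q^{\beta};q)_{n}}{(q^{\gamma};q)_{n}(q;q)_{n}}x^{n}\;{}_{2}\mathbf{\Phi}_{1}(q^{\alpha+n},0;q^{\gamma+n};q,y),$$ $$\mathbf{\Phi}_{1}(q^{\alpha},q^{\beta};q^{\gamma};q,x,y)=\sum_{k=0}^{\infty}\frac{(q^{\alpha};q)_{k}}{(q^{\gamma};q)_{k}(q;q)_{k}}y^{k}\;{}_{2}\mathbf{\Phi}_{1}(q^{\alpha+k},q^{\beta};q^{\gamma+k};q,x),$$ $$\mathbf{\Phi}_{2}(q^{\alpha},q^{\beta};q^{\gamma};q,x,y)=\sum_{n=0}^{\infty}\frac{(q^{\alpha};q)_{n}}{(q^{\gamma};q)_{n}(q;q)_{n}}x^{n}\;{}_{2}\mathbf{\Phi}_{1}(q^{\beta},0;q^{\gamma+n};q,y),$$ $$\mathbf{\Phi}_{2}(q^{\alpha},q^{\beta};q^{\gamma};q,x,y)=\sum_{k=0}^{\infty}\frac{(q^{\beta};q)_{k}}{(q^{\gamma};q)_{k}(q;q)_{k}}y^{k}\;{}_{2}\mathbf{\Phi}_{1}(q^{\alpha},0;q^{\gamma+k};q,x).$$ (ii) If $q^\beta\notin\{1,q^{-1},q^{-2},\dots\}$,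 then $$\mathbf{\Phi}_{3}(q^{\alpha};q^{\beta};q,x,y)=\sum_{n=0}^{\infty}\frac{(q^{\alpha};q)_{n}}{(q^{\beta};q)_{n}(q;q)_{n}}x^{n}\;{}_{2}\mathbf{\Phi}_{1}(0,0;q^{\beta+n};q,y),$$ $$\mathbf{\Phi}_{3}(q^{\alpha};q^{\beta};q,x,y)=\sum_{k=0}^{\infty}\frac{1}{(q^{\beta};q)_{k}(q;q)_{k}}y^{k}\;{}_{2}\mathbf{\Phi}_{1}(q^{\alpha},0;q^{\beta+k};q,x).$$
   Context: Fix $q\in\mathbb{C}$ with $0<|q|<1$ and a choice of $\log q$, so that $q^{z}=e^{z\log q}$ for $z\in\mathbb{C}$. The $q$-shifted factorial is $(a;q)_0=1$, $(a;q)_\ell=\prod_{j=0}^{\ell-1}(1-aq^j)$ for $\ell\ge 1$ (so $(0;q)_\ell=1$). The basic hypergeometric series is ${}_{2}\mathbf{\Phi}_{1}(a,b;c;q,z)=\sum_{n=0}^{\infty}\frac{(a;q)_n(b;q)_n}{(c;q)_n(q;q)_n}z^n$, $|z|<1$. The basic Humbert functions are, for $|x|<1,|y|<1$, $$\mathbf{\Phi}_{1}(q^{\alpha},q^{\beta};q^{\gamma};q,x,y)=\sum_{n,k=0}^{\infty}\frac{(q^{\alpha};q)_{n+k}(q^{\beta};q)_{n}}{(q^{\gamma};q)_{n+k}(q;q)_{n}(q;q)_{k}}x^{n}y^{k},$$ $$\mathbf{\Phi}_{2}(q^{\alpha},q^{\beta};q^{\gamma};q,x,y)=\sum_{n,k=0}^{\infty}\frac{(q^{\alpha};q)_{n}(q^{\beta};q)_{k}}{(q^{\gamma};q)_{n+k}(q;q)_{n}(q;q)_{k}}x^{n}y^{k},$$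 $$\mathbf{\Phi}_{3}(q^{\alpha};q^{\beta};q,x,y)=\sum_{n,k=0}^{\infty}\frac{(q^{\alpha};q)_{n}}{(q^{\beta};q)_{n+k}(q;q)_{n}(q;q)_{k}}x^{n}y^{k},$$ defined when the denominator parameter ($q^\gamma$ for $\mathbf\Phi_1,\mathbf\Phi_2$; $q^\beta$ for $\mathbf\Phi_3$) is not in $\{1,q^{-1},q^{-2},\dots\}$. *)

(* Defs.v *)
From Stdlib Require Export Reals List.
From Coquelicot Require Export Coquelicot.
Open Scope C_scope.

Definition Cexp (z : C) : C :=
  (exp (Re z) * cos (Im z), exp (Re z) * sin (Im z))%R.

(* The power [q^z] for complex [z], relative to a chosen logarithm of [q]. *)
Definition qpow (logq z : C) : C := Cexp (z * logq).

Fixpoint qpoch (a q : C) (l : nat) : C :=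
  match l with
  | O => 1
  | S j => qpoch a q j * (1 - a * q ^ j)
  end.

(* [c] is not in {1, q^-1, q^-2, ...}. *)
Definition admissible (q c : C) : Prop := forall m : nat, c <> / q ^ m.

(* The sum of a convergent series, unspecified otherwise. *)
Definition Cseries (a : nat -> C) : C :=
  iota (T := C_CompleteNormedModule) (fun l : C => is_series a l).

(* Sums over all pairs (n, k) are unconditional: limits of finite partial sums
   along the finite subsets of [nat * nat] ordered by inclusion, a finite subset
   being represented by a duplicate-free list. *)
Definition finite_subsets (P : list (nat * nat) -> Prop) : Prop :=
  exists L : list (nat * nat),
    forall L' : list (nat * nat), NoDup L' -> incl L L' -> P L'.

Definition sum_pairs (a : nat -> nat -> C) (L : list (nat * nat)) : C :=
  fold_right (fun p s => a (fst p) (snd p) + s) 0 L.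

Definition is_double_series (a : nat -> nat -> C) (l : C) : Prop :=
  filterlim (sum_pairs a) finite_subsets (locally l).

(* The sum of a summable double family, unspecified otherwise. *)
Definition double_series (a : nat -> nat -> C) : C :=
  iota (T := C_CompleteNormedModule) (is_double_series a).

Definition phi21_term (a b c q z : C) (n : nat) : C :=
  qpoch a q n * qpoch b q n / (qpoch c q n * qpoch q q n) * z ^ n.

Definition phi21 (a b c q z : C) : C := Cseries (phi21_term a b c q z).

Definition Phi1_term (a b c q x y : C) (n k : nat) : C :=
  qpoch a q (n + k) * qpoch b q n
    / (qpoch c q (n + k) * qpoch q q n * qpoch q q k) * x ^ n * y ^ k.

Definition Phi1 (a b c q x y : C) : C := double_series (Phi1_term a b c q x y).

Definition Phi2_term (a b c q x y : C) (n k : nat) : C :=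
  qpoch a q n * qpoch b q k
    / (qpoch c q (n + k) * qpoch q q n * qpoch q q k) * x ^ n * y ^ k.

Definition Phi2 (a b c q x y : C) : C := double_series (Phi2_term a b c q x y).

Definition Phi3_term (a b q x y : C) (n k : nat) : C :=
  qpoch a q n
    / (qpoch b q (n + k) * qpoch q q n * qpoch q q k) * x ^ n * y ^ k.

Definition Phi3 (a b q x y : C) : C := double_series (Phi3_term a b q x y).

(* Main.v *)
(* Since [(a; q)_n] and, for admissible [c], [1 / (c; q)_n] are bounded in [n],
   the terms of each double series are dominated by [M |x|^n |y|^k], so the
   double series converges unconditionally and may be summed by rows or by
   columns.  The splitting [(a; q)_(n+k) = (a; q)_n (a q^n; q)_k] together with
   [q^(alpha+n) = q^alpha q^n] identifies each row and each column as a multiple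
   of a 2Phi1 series. *)

From Stdlib Require Import Lia Lra Permutation.
Require Import Defs.

(** * Unconditional summation over pairs *)

(** With lists standing for finite sets, [R] plays the complement of [L] in [L']: a sum over [L']
    splits into the sum over [L] and a remainder. *)
Lemma NoDup_incl_Permutation_app {A : Type} (L L' : list A) :
  NoDup L -> incl L L' -> exists R, Permutation L' (L ++ R).
Proof.
  revert L'; induction L as [|x L IH]; intros L' HL HI.
  - exists L'; apply Permutation_refl.
  - inversion HL as [|? ? Hx HL']; subst.
    destruct (in_split x L' (HI x (or_introl eq_refl))) as (l1 & l2 & ->).
    destruct (IH (l1 ++ l2) HL') as [T HT].
    { intros z Hz. destruct (in_app_or _ _ _ (HI z (or_intror Hz))) as [H|[H|H]].
      - now apply in_or_app; left.
      - now subst z.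
      - now apply in_or_app; right. }
    exists T; simpl.
    apply Permutation_trans with (x :: l1 ++ l2).
    + apply Permutation_sym, Permutation_middle.
    + now apply perm_skip.
Qed.

Lemma NoDup_list_prod {A B : Type} (L : list A) (L' : list B) :
  NoDup L -> NoDup L' -> NoDup (list_prod L L').
Proof.
  intros HL HL'; induction HL as [|x L Hx HL IH]; simpl; [constructor|].
  apply NoDup_app; [|easy|].
  - apply FinFun.Injective_map_NoDup; [|easy]. now intros y y' [= ->].
  - intros [x' y] Hy Hxy; apply in_map_iff in Hy as (z & [= <- _] & _).
    apply in_prod_iff in Hxy as [Hxy _]; contradiction.
Qed.

Lemma sum_pairs_app (a : nat -> nat -> C) (L L' : list (nat * nat)) :
  sum_pairs a (L ++ L') = sum_pairs a L + sum_pairs a L'.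
Proof.
  induction L as [|p L IH]; simpl; [ring|rewrite IH; ring].
Qed.

Lemma sum_pairs_Permutation (a : nat -> nat -> C) (L L' : list (nat * nat)) :
  Permutation L L' -> sum_pairs a L = sum_pairs a L'.
Proof.
  induction 1; simpl; [easy|congruence|ring|congruence].
Qed.

Lemma sum_pairs_map_pair (a : nat -> nat -> C) (n K : nat) :
  sum_pairs a (map (pair n) (seq 0 (S K))) = sum_n (a n) K.
Proof.
  induction K as [|K IH].
  - rewrite sum_O; simpl; ring.
  - rewrite seq_S, map_app, sum_pairs_app, IH, sum_Sn; simpl.
    change plus with Cplus; ring.
Qed.

(** Rectangles link sums over finite sets to iterated sums. The sum over [k] is outermost so that
    [N] can be held fixed while [K] tends to infinity. *)
Lemma sum_pairs_rectangle (a : nat -> nat -> C) (N K : nat) :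
  sum_pairs a (list_prod (seq 0 (S N)) (seq 0 (S K)))
  = sum_n (fun k => sum_n (fun n => a n k) N) K.
Proof.
  rewrite <- sum_n_switch.
  assert (Happ : forall l1 l2 l, sum_pairs a (list_prod (l1 ++ l2) l)
    = sum_pairs a (list_prod l1 l) + sum_pairs a (list_prod l2 l)).
  { intros l1 l2 l; induction l1 as [|n l1 IH]; simpl; [ring|].
    rewrite !sum_pairs_app, IH; ring. }
  induction N as [|N IH].
  - rewrite sum_O; cbn [seq list_prod]. rewrite app_nil_r.
    apply sum_pairs_map_pair.
  - rewrite seq_S, Happ, IH, sum_Sn; cbn [list_prod].
    rewrite app_nil_r, sum_pairs_map_pair; reflexivity.
Qed.

(** * Real majorants of finite sums over pairs *)

Definition Rsum_pairs (b : nat -> nat -> R) (L : list (nat * nat)) : R :=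
  fold_right (fun p s => b (fst p) (snd p) + s)%R 0%R L.

Lemma Rsum_pairs_app (b : nat -> nat -> R) (L L' : list (nat * nat)) :
  Rsum_pairs b (L ++ L') = (Rsum_pairs b L + Rsum_pairs b L')%R.
Proof.
  induction L as [|p L IH]; simpl; [ring|rewrite IH; ring].
Qed.

Lemma Rsum_pairs_Permutation (b : nat -> nat -> R) (L L' : list (nat * nat)) :
  Permutation L L' -> Rsum_pairs b L = Rsum_pairs b L'.
Proof.
  induction 1; simpl; [easy|congruence|ring|congruence].
Qed.

Lemma Rsum_pairs_ge_0 (b : nat -> nat -> R) (L : list (nat * nat)) :
  (forall n k, (0 <= b n k)%R) -> (0 <= Rsum_pairs b L)%R.
Proof.
  intros Hb; induction L as [|p L IH]; simpl; [lra|].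
  specialize (Hb (fst p) (snd p)); lra.
Qed.

Lemma Cmod_sum_pairs_le (a : nat -> nat -> C) (b : nat -> nat -> R) (L : list (nat * nat)) :
  (forall n k, (Cmod (a n k) <= b n k)%R) -> (Cmod (sum_pairs a L) <= Rsum_pairs b L)%R.
Proof.
  intros Hab; induction L as [|p L IH]; simpl.
  - rewrite Cmod_0; lra.
  - eapply Rle_trans; [apply Cmod_triangle|].
    specialize (Hab (fst p) (snd p)); lra.
Qed.

(** A finite set of pairs lies in some square; by positivity its sum is at most that of the square,
    which factors into two finite geometric sums. *)
Lemma Rsum_pairs_geometric_le (M r s : R) (L : list (nat * nat)) :
  (0 <= M)%R -> (0 <= r < 1)%R -> (0 <= s < 1)%R -> NoDup L ->
  (Rsum_pairs (fun n k => M * r ^ n * s ^ k) L <= M / ((1 - r) * (1 - s)))%R.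
Proof.
  intros HM Hr Hs HL.
  set (b := fun n k : nat => (M * r ^ n * s ^ k)%R).
  assert (Hb : forall n k, (0 <= b n k)%R).
  { intros n k; unfold b. repeat apply Rmult_le_pos; try apply pow_le; lra. }
  assert (HN : exists N, incl L (list_prod (seq 0 N) (seq 0 N))).
  { clear HL; induction L as [|[n k] L [N HN]].
    - exists 0%nat; intros z [].
    - exists (N + S n + S k)%nat; intros z [<-|Hz].
      + apply in_prod; apply in_seq; lia.
      + specialize (HN z Hz); destruct z as [n' k'].
        apply in_prod_iff in HN; rewrite !in_seq in HN.
        apply in_prod; apply in_seq; lia. }
  destruct HN as [N HN].
  destruct (NoDup_incl_Permutation_app _ _ HL HN) as [T HT].
  apply Rle_trans with (Rsum_pairs b (list_prod (seq 0 N) (seq 0 N))).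
  { rewrite (Rsum_pairs_Permutation b _ _ HT), Rsum_pairs_app.
    pose proof (Rsum_pairs_ge_0 b T Hb); lra. }
  assert (Hrow : forall n K, Rsum_pairs b (map (pair n) (seq 0 K))
    = (M * r ^ n * ((1 - s ^ K) / (1 - s)))%R).
  { intros n K; induction K as [|K IH]; [simpl; field; lra|].
    rewrite seq_S, map_app, Rsum_pairs_app, IH; unfold b; simpl; field; lra. }
  assert (Hrect : forall l l' K, Rsum_pairs b (list_prod (l ++ l') K)
    = (Rsum_pairs b (list_prod l K) + Rsum_pairs b (list_prod l' K))%R).
  { intros l l' K; induction l as [|n l IH]; simpl; [ring|].
    rewrite !Rsum_pairs_app, IH; ring. }
  assert (HP : forall n, Rsum_pairs b (list_prod (seq 0 n) (seq 0 N))
    = (M * ((1 - r ^ n) / (1 - r)) * ((1 - s ^ N) / (1 - s)))%R).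
  { intros n; induction n as [|n IH]; [simpl; field; lra|].
    rewrite seq_S, Hrect, IH; cbn [list_prod].
    rewrite app_nil_r, Hrow; simpl; field; lra. }
  rewrite HP.
  assert (Hp : forall t : R, (0 <= t < 1)%R -> (0 <= 1 - t ^ N <= 1)%R).
  { intros t Ht; pose proof (pow_le t N (proj1 Ht)).
    pose proof (pow_incr t 1 N (conj (proj1 Ht) (Rlt_le _ _ (proj2 Ht)))) as H1.
    rewrite pow1 in H1; lra. }
  pose proof (Hp r Hr); pose proof (Hp s Hs).
  (* The square gives the full bound times [(1 - r ^ N) * (1 - s ^ N)], a factor of at most 1. *)
  replace (M * ((1 - r ^ N) / (1 - r)) * ((1 - s ^ N) / (1 - s)))%R
    with (M / ((1 - r) * (1 - s)) * ((1 - r ^ N) * (1 - s ^ N)))%R by (field; lra).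
  rewrite <- (Rmult_1_r (M / ((1 - r) * (1 - s)))) at 2.
  apply Rmult_le_compat_l; [|nra].
  apply Rmult_le_pos; [lra|]. apply Rlt_le, Rinv_0_lt_compat; nra.
Qed.

(** * The filter of finite subsets and limits along it *)

#[local] Instance finite_subsets_proper : ProperFilter finite_subsets.
Proof.
  split; [|split].
  - intros P [L HL].
    (* The witness [L] may have repetitions; removing them gives an admissible list that still
       contains [L], so no set of the filter is empty. *)
    set (eq_dec := fun p p' : nat * nat =>
      ltac:(decide equality; apply PeanoNat.Nat.eq_dec) : {p = p'} + {p <> p'}).
    exists (nodup eq_dec L). apply HL.
    + apply NoDup_nodup.
    + intros z Hz; now apply nodup_In.
  - now exists nil.
  - intros P Q [L HL] [L' HL']; exists (L ++ L'); intros L2 HN HI; split.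
    + apply HL; [easy|]. intros z Hz; apply HI, in_or_app; now left.
    + apply HL'; [easy|]. intros z Hz; apply HI, in_or_app; now right.
  - intros P Q HPQ [L HL]; exists L; intros L' HN HI; now apply HPQ, HL.
Qed.

Lemma double_series_unique (a : nat -> nat -> C) (l : C) :
  is_double_series a l -> double_series a = l.
Proof.
  exact (iota_filterlim_locally (V := C_CompleteNormedModule) (sum_pairs a) l).
Qed.

Lemma Cseries_unique (a : nat -> C) (l : C) : is_series a l -> Cseries a = l.
Proof.
  exact (iota_filterlim_locally (V := C_CompleteNormedModule) (sum_n a) l).
Qed.

Lemma Cseries_correct (a : nat -> C) : ex_series a -> is_series a (Cseries a).
Proof.
  intros [l Hl]; now rewrite (Cseries_unique a l Hl).
Qed.

(* Finite sums outside a finite set that nearly exhausts the supremum of the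
   sums of [b] are small, so the net of finite sums of [a] is Cauchy. *)
Lemma double_series_correct (a : nat -> nat -> C) (b : nat -> nat -> R) (B : R) :
  (forall n k, (Cmod (a n k) <= b n k)%R) ->
  (forall L, NoDup L -> (Rsum_pairs b L <= B)%R) ->
  is_double_series a (double_series a).
Proof.
  intros Hab HB.
  assert (Hb : forall n k, (0 <= b n k)%R).
  { intros n k; eapply Rle_trans; [apply Cmod_ge_0|apply Hab]. }
  (* Limits being unique, it suffices that some limit exists, and completeness reduces this to the
     Cauchy criterion. *)
  cut (exists l : C_CompleteNormedModule, filterlim (sum_pairs a) finite_subsets (locally l)).
  { intros [l Hl]; now rewrite (double_series_unique a l Hl). }
  apply (proj1 (filterlim_locally_cauchy (U := C_CompleteNormedModule) (sum_pairs a))).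
  intros eps.
  destruct (completeness (fun t => exists L, NoDup L /\ t = Rsum_pairs b L)) as [m [Hub Hlub]].
  { exists B; intros t (L & HL & ->); now apply HB. }
  { exists 0%R, nil; split; [constructor|easy]. }
  assert (HL0 : exists L0, NoDup L0 /\ (m - eps / 2 < Rsum_pairs b L0)%R).
  { apply Classical_Prop.NNPP; intros Hn.
    assert (m <= m - eps / 2)%R; [|pose proof (cond_pos eps); lra].
    apply Hlub; intros t (L & HL & ->).
    apply Rnot_lt_le; intros Hlt; apply Hn; now exists L. }
  destruct HL0 as (L0 & HN0 & Hm0).
  assert (Htail : forall L, NoDup L -> incl L0 L ->
    (Cmod (sum_pairs a L - sum_pairs a L0) < eps / 2)%R).
  { intros L HL HI.
    destruct (NoDup_incl_Permutation_app _ _ HN0 HI) as [T HT].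
    rewrite (sum_pairs_Permutation a _ _ HT), sum_pairs_app.
    replace (sum_pairs a L0 + sum_pairs a T - sum_pairs a L0) with (sum_pairs a T) by ring.
    pose proof (Cmod_sum_pairs_le a b T Hab).
    assert (HmL : (Rsum_pairs b L <= m)%R) by (apply Hub; now exists L).
    rewrite (Rsum_pairs_Permutation b _ _ HT), Rsum_pairs_app in HmL; lra. }
  exists (fun L => NoDup L /\ incl L0 L); split.
  - now exists L0.
  - intros u v [Hu HIu] [Hv HIv].
    apply C_NormedModule_mixin_compat1.
    change (Cmod (sum_pairs a v - sum_pairs a u) < eps)%R.
    replace (sum_pairs a v - sum_pairs a u)
      with ((sum_pairs a v - sum_pairs a L0) + - (sum_pairs a u - sum_pairs a L0)) by ring.
    eapply Rle_lt_trans; [apply Cmod_triangle|]. rewrite Cmod_opp.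
    pose proof (Htail u Hu HIu); pose proof (Htail v Hv HIv); lra.
Qed.

(** Transposing pairs is an involution that preserves finite sets and inclusion. Expansions by
    columns thereby reduce to expansions by rows. *)
Lemma is_double_series_swap (a : nat -> nat -> C) (l : C) :
  is_double_series a l -> is_double_series (fun n k => a k n) l.
Proof.
  intros Ha P HP. destruct (Ha P HP) as [L HL].
  set (swap := fun p : nat * nat => (snd p, fst p)).
  assert (Hswap : forall p, swap (swap p) = p) by now intros [].
  exists (map swap L); intros L' HN HI.
  replace (sum_pairs (fun n k => a k n) L') with (sum_pairs a (map swap L')).
  - apply HL.
    + apply FinFun.Injective_map_NoDup; [|easy].
      intros p p' E; rewrite <- (Hswap p), E; apply Hswap.
    + intros p Hp; rewrite <- (Hswap p); apply in_map, HI, in_map, Hp.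
  - clear; induction L' as [|p L' IH]; simpl; [easy|now rewrite IH].
Qed.

(** A rectangle containing a suitable finite set has sum within [eps / 2] of [l]. For fixed height
    [N], a wide enough rectangle is also within [eps / 2] of the sum of its full rows. *)
Lemma is_double_series_rows (a : nat -> nat -> C) (l : C) :
  (forall n, ex_series (a n)) -> is_double_series a l ->
  is_series (fun n => Cseries (a n)) l.
Proof.
  intros Hrow Ha.
  apply (filterlim_locally_ball_norm (U := C_NormedModule)); intros eps.
  pose proof (proj1 (filterlim_locally_ball_norm (U := C_NormedModule) (sum_pairs a) l) Ha
    (pos_div_2 eps)) as [L HL].
  assert (HM : exists M, forall p, In p L -> (fst p <= M /\ snd p <= M)%nat).
  { clear; induction L as [|p L [M HM]]; [now exists 0%nat|].
    exists (M + fst p + snd p)%nat; intros p' [<-|Hp]; [lia|].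
    specialize (HM p' Hp); lia. }
  destruct HM as [M HM].
  exists M; intros N HN.
  (* Finitely many convergent rows may be added termwise. *)
  assert (HS : is_series (fun k => sum_n (fun n => a n k) N) (sum_n (fun n => Cseries (a n)) N)).
  { clear HN; induction N as [|N IH].
    - rewrite sum_O. apply is_series_ext with (a 0%nat).
      + intros k; now rewrite sum_O.
      + now apply Cseries_correct.
    - rewrite sum_Sn.
      apply is_series_ext with (fun k => plus (sum_n (fun n => a n k) N) (a (S N) k)).
      + intros k; now rewrite sum_Sn.
      + apply (is_series_plus (V := C_NormedModule)); [easy|]. now apply Cseries_correct. }
  pose proof (proj1 (filterlim_locally_ball_norm (U := C_NormedModule) _ _) HS
    (pos_div_2 eps)) as [K HK].
  (* The width [max K M] serves both estimates: [K] for convergence of the rows, [M] for containing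
     [L]. *)
  specialize (HK (max K M) ltac:(lia)).
  rewrite <- sum_pairs_rectangle in HK.
  specialize (HL (list_prod (seq 0 (S N)) (seq 0 (S (max K M))))).
  assert (HL' : ball_norm (V := C_NormedModule) l (pos_div_2 eps)
    (sum_pairs a (list_prod (seq 0 (S N)) (seq 0 (S (max K M)))))).
  { apply HL.
    - apply NoDup_list_prod; apply seq_NoDup.
    - intros [n k] Hp; specialize (HM _ Hp); simpl in HM.
      apply in_prod; apply in_seq; lia. }
  revert HK HL'; generalize (sum_pairs a (list_prod (seq 0 (S N)) (seq 0 (S (max K M))))).
  intros R HK HL'.
  pose proof (ball_norm_triangle (V := C_NormedModule) _ _ _ _ _ HL' (ball_norm_sym _ _ _ HK)) as HT.
  replace (pos eps) with (pos_div_2 eps + pos_div_2 eps)%R by (simpl; field).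
  exact HT.
Qed.

(** The form in which all six expansions are obtained: [u n] is the outer coefficient and [f n] the
    term of the inner 2Phi1 series. *)
Lemma is_double_series_rows_scal (t : nat -> nat -> C) (l : C) (u : nat -> C) (f : nat -> nat -> C) :
  (forall n, ex_series (f n)) -> (forall n k, t n k = u n * f n k) ->
  is_double_series t l -> is_series (fun n => u n * Cseries (f n)) l.
Proof.
  intros Hf Ht Hl.
  assert (Hrow : forall n, is_series (t n) (u n * Cseries (f n))).
  { intros n. apply is_series_ext with (fun k => scal (u n) (f n k)).
    - intros k; now rewrite Ht.
    - apply (is_series_scal (V := C_NormedModule)), Cseries_correct, Hf. }
  apply is_series_ext with (fun n => Cseries (t n)).
  - intros n; apply Cseries_unique, Hrow.
  - apply is_double_series_rows; [|easy]. intros n; eexists; apply Hrow.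
Qed.

(** * Bounds on q-shifted factorials *)

(** The index type is arbitrary so that sequences and families over pairs share the same rules. *)
Definition Cbounded {I : Type} (u : I -> C) : Prop :=
  exists M, forall i, (Cmod (u i) <= M)%R.

Lemma Cbounded_ge_0 {I : Type} (u : I -> C) :
  Cbounded u -> exists M, (0 <= M)%R /\ forall i, (Cmod (u i) <= M)%R.
Proof.
  intros [M HM]; exists (Rabs M); split; [apply Rabs_pos|].
  intros i; eapply Rle_trans; [apply HM|apply Rle_abs].
Qed.

Lemma Cbounded_comp {I J : Type} (f : J -> I) (u : I -> C) :
  Cbounded u -> Cbounded (fun j => u (f j)).
Proof.
  intros [M HM]; now exists M.
Qed.

Lemma Cbounded_mult {I : Type} (u v : I -> C) :
  Cbounded u -> Cbounded v -> Cbounded (fun i => u i * v i).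
Proof.
  intros [M HM] [M' HM']; exists (M * M')%R; intros i; rewrite Cmod_mult.
  apply Rmult_le_compat; auto using Cmod_ge_0.
Qed.

Lemma ex_series_Cbounded (w : nat -> C) (z : C) :
  Cbounded w -> (Cmod z < 1)%R -> ex_series (fun n => w n * z ^ n).
Proof.
  intros [M HM] Hz.
  apply (ex_series_le (V := C_CompleteNormedModule) _ (fun n => (Cmod z ^ n * M)%R)).
  - intros n; change (Cmod (w n * z ^ n) <= Cmod z ^ n * M)%R.
    rewrite Cmod_mult, Cmod_pow, Rmult_comm.
    apply Rmult_le_compat_l; [apply pow_le, Cmod_ge_0|apply HM].
  - eexists; apply is_series_scal_r, is_series_geom.
    now rewrite Rabs_pos_eq by apply Cmod_ge_0.
Qed.

Lemma double_series_Cbounded (w : nat -> nat -> C) (x y : C) :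
  Cbounded (fun p => w (fst p) (snd p)) -> (Cmod x < 1)%R -> (Cmod y < 1)%R ->
  let t := fun n k => w n k * x ^ n * y ^ k in is_double_series t (double_series t).
Proof.
  intros Hw Hx Hy t.
  destruct (Cbounded_ge_0 _ Hw) as (M & HM0 & HM).
  apply (double_series_correct t (fun n k => M * Cmod x ^ n * Cmod y ^ k)%R
    (M / ((1 - Cmod x) * (1 - Cmod y)))).
  - intros n k; unfold t; rewrite !Cmod_mult, !Cmod_pow.
    apply Rmult_le_compat_r; [apply pow_le, Cmod_ge_0|].
    apply Rmult_le_compat_r; [apply pow_le, Cmod_ge_0|].
    exact (HM (n, k)).
  - intros L; apply Rsum_pairs_geometric_le; auto using Cmod_ge_0.
Qed.

Lemma qpoch_add (a q : C) (n k : nat) :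
  qpoch a q (n + k) = qpoch a q n * qpoch (a * q ^ n) q k.
Proof.
  induction k as [|k IH]; simpl.
  - rewrite PeanoNat.Nat.add_0_r; ring.
  - rewrite PeanoNat.Nat.add_succ_r; simpl; rewrite IH, Cpow_add_r; ring.
Qed.

Lemma qpoch_0_l (q : C) (n : nat) : qpoch 0 q n = 1.
Proof.
  induction n as [|n IH]; simpl; [easy|rewrite IH; ring].
Qed.

(** The exponent is the partial sum [A * (1 + r + ... + r ^ (n - 1))] in closed form, so one more
    term multiplies the exponential by [exp (A * r ^ n)]. This is the comparison sequence for the
    products below. *)
Lemma exp_geometric_step (A r : R) (n : nat) : (0 <= r < 1)%R ->
  (exp (A * ((1 - r ^ S n) / (1 - r))) = exp (A * ((1 - r ^ n) / (1 - r))) * exp (A * r ^ n))%R.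
Proof.
  intros Hr; rewrite <- exp_plus; f_equal; simpl; field; lra.
Qed.

Lemma exp_geometric_le (A r : R) (n : nat) : (0 <= A)%R -> (0 <= r < 1)%R ->
  (exp (A * ((1 - r ^ n) / (1 - r))) <= exp (A / (1 - r)))%R.
Proof.
  intros HA Hr.
  assert (H : (A * ((1 - r ^ n) / (1 - r)) <= A / (1 - r))%R).
  { unfold Rdiv; apply Rmult_le_compat_l; [easy|].
    rewrite <- (Rmult_1_l (/ (1 - r))) at 2.
    apply Rmult_le_compat_r; [apply Rlt_le, Rinv_0_lt_compat; lra|].
    pose proof (pow_le r n (proj1 Hr)); lra. }
  destruct H as [H|H]; [now apply Rlt_le, exp_increasing|now rewrite H; apply Rle_refl].
Qed.

(** Each factor satisfies [|1 - a q^j| <= 1 + |a| |q|^j <= exp (|a| |q|^j)], and the exponents sum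
    to at most [|a| / (1 - |q|)]. *)
Lemma Cbounded_qpoch (a q : C) : (Cmod q < 1)%R -> Cbounded (qpoch a q).
Proof.
  intros hq1.
  assert (Hr : (0 <= Cmod q < 1)%R) by (split; [apply Cmod_ge_0|easy]).
  exists (exp (Cmod a / (1 - Cmod q))); intros n.
  (* The induction needs the sharper bound with the partial geometric sum, since the limiting
     constant leaves no room for a further factor. *)
  eapply Rle_trans; [|apply (exp_geometric_le (Cmod a) (Cmod q) n); [apply Cmod_ge_0|easy]].
  induction n as [|n IH].
  - simpl; rewrite Cmod_1, Rminus_diag, Rdiv_0_l, Rmult_0_r, exp_0; lra.
  - rewrite exp_geometric_step by easy; cbn [qpoch]; rewrite Cmod_mult.
    apply Rmult_le_compat; [apply Cmod_ge_0|apply Cmod_ge_0|easy|].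
    eapply Rle_trans; [apply Cmod_triangle|].
    rewrite Cmod_1, Cmod_opp, Cmod_mult, Cmod_pow; apply exp_ineq1_le.
Qed.

Lemma Cmod_1_sub_ge (c q : C) (n : nat) :
  (1 - Cmod c * Cmod q ^ n <= Cmod (1 - c * q ^ n))%R.
Proof.
  pose proof (Cmod_triangle (1 - c * q ^ n) (c * q ^ n)) as H.
  replace (1 - c * q ^ n + c * q ^ n) with (RtoC 1) in H by ring.
  rewrite Cmod_1, Cmod_mult, Cmod_pow in H; lra.
Qed.

(** Every [t = |c| |q|^n] lies in [[0, 1/2]], so no factor vanishes and each reciprocal is at most
    [1 / (1 - t) <= 1 + 2 t <= exp (2 t)]; hence the factor 2 in the bounding exponent. *)
Lemma Cbounded_inv_qpoch_small (c q : C) :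
  (Cmod q < 1)%R -> (Cmod c <= / 2)%R -> Cbounded (fun n => / qpoch c q n).
Proof.
  intros hq1 Hc.
  assert (Hr : (0 <= Cmod q < 1)%R) by (split; [apply Cmod_ge_0|easy]).
  assert (Hf : forall n, (0 <= Cmod c * Cmod q ^ n <= / 2)%R).
  { intros n; pose proof (pow_le _ n (proj1 Hr)).
    pose proof (pow_incr _ 1 n (conj (proj1 Hr) (Rlt_le _ _ hq1))) as H1.
    rewrite pow1 in H1; pose proof (Cmod_ge_0 c); nra. }
  assert (Hfac : forall n, 1 - c * q ^ n <> 0).
  { intros n; apply Cmod_gt_0; pose proof (Cmod_1_sub_ge c q n); specialize (Hf n); lra. }
  assert (Hnz : forall n, qpoch c q n <> 0).
  { intros n; induction n as [|n IH]; simpl.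
    - intros H; apply RtoC_inj in H; lra.
    - now apply Cmult_neq_0. }
  exists (exp (2 * Cmod c / (1 - Cmod q))); intros n.
  eapply Rle_trans; [|apply (exp_geometric_le (2 * Cmod c) (Cmod q) n);
    [pose proof (Cmod_ge_0 c); lra|easy]].
  rewrite Cmod_inv by easy.
  induction n as [|n IH].
  - simpl; rewrite Cmod_1, Rminus_diag, Rdiv_0_l, Rmult_0_r, exp_0; lra.
  - rewrite exp_geometric_step by easy; cbn [qpoch]; rewrite Cmod_mult, Rinv_mult.
    pose proof (proj1 (Cmod_gt_0 _) (Hnz n)); pose proof (proj1 (Cmod_gt_0 _) (Hfac n)).
    apply Rmult_le_compat; [now apply Rlt_le, Rinv_0_lt_compat..|easy|].
    eapply Rle_trans; [|apply exp_ineq1_le].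
    pose proof (Cmod_1_sub_ge c q n); specialize (Hf n).
    (* [1 / (1 - t) <= 1 + 2 t] for [0 <= t <= 1/2] *)
    apply Rmult_le_reg_l with (Cmod (1 - c * q ^ n)); [easy|].
    rewrite Rinv_r by lra; nra.
Qed.

(** If [c q^n = q^(-m)], then [c = q^(-(m + n))], which is excluded. *)
Lemma admissible_shift (c q : C) (n : nat) :
  q <> 0 -> admissible q c -> admissible q (c * q ^ n).
Proof.
  intros q_neq_0 Hc m E; apply (Hc (m + n)%nat).
  rewrite Cpow_add_r, <- (Cmult_1_r c), <- (Cinv_r (q ^ n)), Cmult_assoc, E
    by now apply Cpow_nz.
  field; split; now apply Cpow_nz.
Qed.

(** Since [q = q^(-m)] would give [q^(m + 1) = 1], against [|q| < 1]. The factors [(q; q)_n] thus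
    fall under the same estimates as [(c; q)_n]. *)
Lemma admissible_self (q : C) : q <> 0 -> (Cmod q < 1)%R -> admissible q q.
Proof.
  intros q_neq_0 hq1 m E.
  assert (H : q ^ S m = 1).
  { rewrite Cpow_S, E at 1; apply Cinv_l; now apply Cpow_nz. }
  apply (f_equal Cmod) in H; rewrite Cmod_pow, Cmod_1 in H.
  assert (Cmod q ^ S m < 1)%R; [|lra].
  apply pow_lt_1_compat; [split; [apply Cmod_ge_0|easy]|lia].
Qed.

Lemma admissible_neq_1 (c q : C) : admissible q c -> 1 - c <> 0.
Proof.
  intros Hc E; apply (Hc 0%nat); simpl.
  replace c with (1 - (1 - c)) by ring; rewrite E; field.
Qed.

Lemma qpoch_neq_0 (c q : C) (n : nat) :
  q <> 0 -> admissible q c -> qpoch c q n <> 0.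
Proof.
  intros q_neq_0 Hc; induction n as [|n IH]; simpl.
  - intros H; apply RtoC_inj in H; lra.
  - apply Cmult_neq_0; [easy|]. now apply (admissible_neq_1 _ q), admissible_shift.
Qed.

(* Peeling off first factors, [(c; q)_(n+1) = (1 - c) (cq; q)_n], reduces to a
   parameter of small modulus. *)
Lemma Cbounded_inv_qpoch (c q : C) :
  q <> 0 -> (Cmod q < 1)%R -> admissible q c -> Cbounded (fun n => / qpoch c q n).
Proof.
  intros q_neq_0 hq1 Hc.
  (* A [J] with [|q|^J < (1/2) / (1 + |c|)] works; [1 + |c|] instead of [|c|] allows [c = 0]. *)
  assert (HJ : exists J, (Cmod (c * q ^ J) <= / 2)%R).
  { destruct (pow_lt_1_zero (Cmod q)) with (y := (/ 2 / (1 + Cmod c))%R) as [J HJ].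
    - now rewrite Rabs_pos_eq by apply Cmod_ge_0.
    - pose proof (Cmod_ge_0 c); apply Rdiv_lt_0_compat; lra.
    - exists J; specialize (HJ J (le_n J)).
      rewrite Cmod_mult, Cmod_pow.
      pose proof (Cmod_ge_0 c) as Hc0; pose proof (pow_le _ J (Cmod_ge_0 q)).
      rewrite Rabs_pos_eq in HJ by easy.
      apply Rmult_lt_compat_r with (r := (1 + Cmod c)%R) in HJ; [|lra].
      replace (/ 2 / (1 + Cmod c) * (1 + Cmod c))%R with (/ 2)%R in HJ by (field; lra).
      nra. }
  (* The parameter is generalized because the induction hypothesis is applied to [c q], which needs
     one shift fewer to become small. *)
  destruct HJ as [J HJ]; revert c Hc HJ.
  induction J as [|J IH]; intros c Hc HJ.
  - apply Cbounded_inv_qpoch_small; now rewrite Cmult_1_r in HJ.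
  - pose proof (admissible_shift c q 1 q_neq_0 Hc) as Hc1.
    destruct (Cbounded_ge_0 _ (IH _ Hc1 ltac:(now rewrite <- Cmult_assoc, <- Cpow_add_r)))
      as (M & HM0 & HM).
    pose proof (admissible_neq_1 c q Hc) as Hn1.
    (* The summand 1 covers [n = 0]; the other covers all [n >= 1]. *)
    exists (1 + Cmod (/ (1 - c)) * M)%R; intros n.
    pose proof (Cmod_ge_0 (/ (1 - c))).
    destruct n as [|n].
    + simpl; rewrite Cmod_inv, Cmod_1, Rinv_1 by (intros H'; apply RtoC_inj in H'; lra). nra.
    + change (S n) with (1 + n)%nat; rewrite qpoch_add.
      replace (/ (qpoch c q 1 * qpoch (c * q ^ 1) q n))
        with (/ (1 - c) * / qpoch (c * q ^ 1) q n).
      * rewrite Cmod_mult; specialize (HM n).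
        apply Rmult_le_compat_l with (r := Cmod (/ (1 - c))) in HM; lra.
      * pose proof (qpoch_neq_0 _ _ n q_neq_0 Hc1); simpl in *; field.
        split; [easy|]. replace (1 * (1 - c * 1)) with (1 - c) by ring; easy.
Qed.

(** * Powers of q and the Humbert series *)

Lemma Cexp_add (z w : C) : Cexp (z + w) = Cexp z * Cexp w.
Proof.
  unfold Cexp; destruct z as [a b], w as [c d]; simpl.
  rewrite exp_plus, cos_plus, sin_plus; unfold Cmult; simpl; f_equal; ring.
Qed.

(** The exponential turns the summand [n log q] into [q^n], whichever logarithm of [q] was
    chosen. *)
Lemma qpow_add_INR (q logq z : C) (n : nat) :
  Cexp logq = q -> qpow logq (z + INR n) = qpow logq z * q ^ n.
Proof.
  intros Hq; unfold qpow.
  replace ((z + INR n) * logq) with (z * logq + INR n * logq) by ring.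
  rewrite Cexp_add; f_equal.
  induction n as [|n IH].
  - simpl; rewrite Cmult_0_l; unfold Cexp; simpl. rewrite exp_0, cos_0, sin_0.
    unfold RtoC; f_equal; ring.
  - rewrite S_INR, RtoC_plus, Cpow_S, <- IH, <- Hq, <- Cexp_add; f_equal; ring.
Qed.

Lemma ex_series_phi21 (a b c q z : C) :
  q <> 0 -> (Cmod q < 1)%R -> (Cmod z < 1)%R -> admissible q c ->
  ex_series (phi21_term a b c q z).
Proof.
  intros q_neq_0 hq1 Hz Hc.
  (* Quotients become products of reciprocals, to which the boundedness rules apply. *)
  set (w := fun n => qpoch a q n * qpoch b q n * (/ qpoch c q n * / qpoch q q n)).
  assert (Hw : forall n, w n * z ^ n = phi21_term a b c q z n).
  { intros n; unfold w, phi21_term.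
    pose proof (qpoch_neq_0 c q n q_neq_0 Hc).
    pose proof (qpoch_neq_0 q q n q_neq_0 (admissible_self q q_neq_0 hq1)).
    field; now split. }
  apply ex_series_ext with (1 := Hw).
  apply ex_series_Cbounded; [|easy].
  repeat apply Cbounded_mult; auto using Cbounded_qpoch, Cbounded_inv_qpoch, admissible_self.
Qed.

(** The three Humbert series share this denominator, so only the numerator is left as a
    parameter. *)
Lemma Cbounded_humbert (num : nat * nat -> C) (c q : C) :
  q <> 0 -> (Cmod q < 1)%R -> admissible q c -> Cbounded num ->
  Cbounded (fun p => num p
    / (qpoch c q (fst p + snd p) * qpoch q q (fst p) * qpoch q q (snd p))).
Proof.
  intros q_neq_0 hq1 Hc Hnum.
  assert (Hq : admissible q q) by now apply admissible_self.
  destruct (Cbounded_mult _ _ Hnum (Cbounded_mult _ _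
    (Cbounded_comp (fun p => fst p + snd p)%nat _ (Cbounded_inv_qpoch c q q_neq_0 hq1 Hc))
    (Cbounded_mult _ _
      (Cbounded_comp fst _ (Cbounded_inv_qpoch q q q_neq_0 hq1 Hq))
      (Cbounded_comp snd _ (Cbounded_inv_qpoch q q q_neq_0 hq1 Hq))))) as [M HM].
  exists M; intros p; eapply Rle_trans; [|apply (HM p)]; apply Req_le; f_equal.
  pose proof (qpoch_neq_0 c q (fst p + snd p) q_neq_0 Hc).
  pose proof (qpoch_neq_0 q q (fst p) q_neq_0 Hq).
  pose proof (qpoch_neq_0 q q (snd p) q_neq_0 Hq).
  field; now repeat split.
Qed.

Theorem theorem2p10 (q logq : C) (hq0 : (0 < Cmod q)%R) (hq1 : (Cmod q < 1)%R)
    (hlogq : Cexp logq = q)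
    (alpha beta gamma x y : C) (hx : (Cmod x < 1)%R) (hy : (Cmod y < 1)%R) :
  (admissible q (qpow logq gamma) ->
    is_double_series (Phi1_term (qpow logq alpha) (qpow logq beta) (qpow logq gamma) q x y)
      (Phi1 (qpow logq alpha) (qpow logq beta) (qpow logq gamma) q x y) /\
    (forall n : nat,
       ex_series (phi21_term (qpow logq (alpha + INR n)) 0 (qpow logq (gamma + INR n)) q y)) /\
    is_series
      (fun n : nat =>
         qpoch (qpow logq alpha) q n * qpoch (qpow logq beta) q n / (qpoch (qpow logq gamma) q n * qpoch q q n) * x ^ n
         * phi21 (qpow logq (alpha + INR n)) 0 (qpow logq (gamma + INR n)) q y)
      (Phi1 (qpow logq alpha) (qpow logq beta) (qpow logq gamma) q x y) /\
    (forall k : nat,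
       ex_series (phi21_term (qpow logq (alpha + INR k)) (qpow logq beta) (qpow logq (gamma + INR k)) q x)) /\
    is_series
      (fun k : nat =>
         qpoch (qpow logq alpha) q k / (qpoch (qpow logq gamma) q k * qpoch q q k) * y ^ k
         * phi21 (qpow logq (alpha + INR k)) (qpow logq beta) (qpow logq (gamma + INR k)) q x)
      (Phi1 (qpow logq alpha) (qpow logq beta) (qpow logq gamma) q x y) /\
    is_double_series (Phi2_term (qpow logq alpha) (qpow logq beta) (qpow logq gamma) q x y)
      (Phi2 (qpow logq alpha) (qpow logq beta) (qpow logq gamma) q x y) /\
    (forall n : nat,
       ex_series (phi21_term (qpow logq beta) 0 (qpow logq (gamma + INR n)) q y)) /\
    is_series
      (fun n : nat =>
         qpoch (qpow logq alpha) q n / (qpoch (qpow logq gamma) q n * qpoch q q n) * x ^ n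
         * phi21 (qpow logq beta) 0 (qpow logq (gamma + INR n)) q y)
      (Phi2 (qpow logq alpha) (qpow logq beta) (qpow logq gamma) q x y) /\
    (forall k : nat,
       ex_series (phi21_term (qpow logq alpha) 0 (qpow logq (gamma + INR k)) q x)) /\
    is_series
      (fun k : nat =>
         qpoch (qpow logq beta) q k / (qpoch (qpow logq gamma) q k * qpoch q q k) * y ^ k
         * phi21 (qpow logq alpha) 0 (qpow logq (gamma + INR k)) q x)
      (Phi2 (qpow logq alpha) (qpow logq beta) (qpow logq gamma) q x y)) /\
  (admissible q (qpow logq beta) ->
    is_double_series (Phi3_term (qpow logq alpha) (qpow logq beta) q x y)
      (Phi3 (qpow logq alpha) (qpow logq beta) q x y) /\
    (forall n : nat,
       ex_series (phi21_term 0 0 (qpow logq (beta + INR n)) q y)) /\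
    is_series
      (fun n : nat =>
         qpoch (qpow logq alpha) q n / (qpoch (qpow logq beta) q n * qpoch q q n) * x ^ n
         * phi21 0 0 (qpow logq (beta + INR n)) q y)
      (Phi3 (qpow logq alpha) (qpow logq beta) q x y) /\
    (forall k : nat,
       ex_series (phi21_term (qpow logq alpha) 0 (qpow logq (beta + INR k)) q x)) /\
    is_series
      (fun k : nat =>
         1 / (qpoch (qpow logq beta) q k * qpoch q q k) * y ^ k
         * phi21 (qpow logq alpha) 0 (qpow logq (beta + INR k)) q x)
      (Phi3 (qpow logq alpha) (qpow logq beta) q x y)).
Proof.
  assert (q_neq_0 : q <> 0) by now apply Cmod_gt_0.
  assert (Hq : admissible q q) by now apply admissible_self.
  (* This makes every inner series, with parameter [q^(gamma + n)] or [q^(beta + n)], well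
     defined. *)
  assert (Hshift : forall z, admissible q (qpow logq z) ->
    forall n : nat, admissible q (qpow logq (z + INR n))).
  { intros z Hz n; rewrite (qpow_add_INR q) by easy; now apply admissible_shift. }
  split; intros Hc.
  - assert (H1 : is_double_series
      (Phi1_term (qpow logq alpha) (qpow logq beta) (qpow logq gamma) q x y)
      (Phi1 (qpow logq alpha) (qpow logq beta) (qpow logq gamma) q x y)).
    { apply (double_series_Cbounded (fun n k => qpoch _ q (n + k) * qpoch _ q n
        / (qpoch _ q (n + k) * qpoch q q n * qpoch q q k))); [|easy|easy].
      apply (Cbounded_humbert (fun p => qpoch _ q (fst p + snd p) * qpoch _ q (fst p)));
        [easy..|].
      apply Cbounded_mult.
      - apply (Cbounded_comp (fun p => fst p + snd p)%nat); now apply Cbounded_qpoch.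
      - apply (Cbounded_comp fst (qpoch _ q)); now apply Cbounded_qpoch. }
    assert (H2 : is_double_series
      (Phi2_term (qpow logq alpha) (qpow logq beta) (qpow logq gamma) q x y)
      (Phi2 (qpow logq alpha) (qpow logq beta) (qpow logq gamma) q x y)).
    { apply (double_series_Cbounded (fun n k => qpoch _ q n * qpoch _ q k
        / (qpoch _ q (n + k) * qpoch q q n * qpoch q q k))); [|easy|easy].
      apply (Cbounded_humbert (fun p => qpoch _ q (fst p) * qpoch _ q (snd p)));
        [easy..|].
      apply Cbounded_mult.
      - apply (Cbounded_comp fst (qpoch _ q)); now apply Cbounded_qpoch.
      - apply (Cbounded_comp snd (qpoch _ q)); now apply Cbounded_qpoch. }
    assert (E1 : forall n : nat, ex_series
      (phi21_term (qpow logq (alpha + INR n)) 0 (qpow logq (gamma + INR n)) q y))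
      by (intros; apply ex_series_phi21; auto).
    assert (E2 : forall n : nat, ex_series
      (phi21_term (qpow logq (alpha + INR n)) (qpow logq beta) (qpow logq (gamma + INR n)) q x))
      by (intros; apply ex_series_phi21; auto).
    assert (E3 : forall n : nat, ex_series
      (phi21_term (qpow logq beta) 0 (qpow logq (gamma + INR n)) q y))
      by (intros; apply ex_series_phi21; auto).
    assert (E4 : forall n : nat, ex_series
      (phi21_term (qpow logq alpha) 0 (qpow logq (gamma + INR n)) q x))
      by (intros; apply ex_series_phi21; auto).
    (* These are all the denominators that occur once [(q^gamma; q)_(n+k)] is split. *)
    assert (Hnz : forall n k, qpoch (qpow logq gamma) q n <> 0
      /\ qpoch (qpow logq gamma * q ^ n) q k <> 0 /\ qpoch q q n <> 0 /\ qpoch q q k <> 0).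
    { intros n k; repeat split; apply qpoch_neq_0; auto using admissible_shift. }
    refine (conj H1 (conj E1 (conj _ (conj E2 (conj _
      (conj H2 (conj E3 (conj _ (conj E4 _))))))))).
    + apply (is_double_series_rows_scal _ _ _ _ E1) with (2 := H1).
      intros n k; unfold Phi1_term, phi21_term.
      rewrite !(qpow_add_INR q), !qpoch_add, qpoch_0_l by easy.
      pose proof (Hnz n k); field; tauto.
    (* Column [k] is a row of the transposed family; [(q^beta; q)_n] depends on the inner index only
       and remains inside the 2Phi1. *)
    + apply (is_double_series_rows_scal _ _ _ _ E2) with (2 := is_double_series_swap _ _ H1).
      intros k n; unfold Phi1_term, phi21_term.
      rewrite (PeanoNat.Nat.add_comm n k), !(qpow_add_INR q), !qpoch_add by easy.
      pose proof (Hnz k n); field; tauto.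
    (* For [Phi2] only the denominator couples [n] and [k], so the numerator parameters stay
       unshifted; the zero parameter contributes [(0; q)_k = 1]. *)
    + apply (is_double_series_rows_scal _ _ _ _ E3) with (2 := H2).
      intros n k; unfold Phi2_term, phi21_term.
      rewrite !(qpow_add_INR q), !qpoch_add, qpoch_0_l by easy.
      pose proof (Hnz n k); field; tauto.
    + apply (is_double_series_rows_scal _ _ _ _ E4) with (2 := is_double_series_swap _ _ H2).
      intros k n; unfold Phi2_term, phi21_term.
      rewrite (PeanoNat.Nat.add_comm n k), !(qpow_add_INR q), !qpoch_add, qpoch_0_l by easy.
      pose proof (Hnz k n); field; tauto.
  - assert (H3 : is_double_series
      (Phi3_term (qpow logq alpha) (qpow logq beta) q x y)
      (Phi3 (qpow logq alpha) (qpow logq beta) q x y)).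
    { apply (double_series_Cbounded (fun n k => qpoch _ q n
        / (qpoch _ q (n + k) * qpoch q q n * qpoch q q k))); [|easy|easy].
      apply (Cbounded_humbert (fun p => qpoch _ q (fst p))); [easy..|].
      apply (Cbounded_comp fst (qpoch _ q)); now apply Cbounded_qpoch. }
    assert (E1 : forall n : nat, ex_series
      (phi21_term 0 0 (qpow logq (beta + INR n)) q y))
      by (intros; apply ex_series_phi21; auto).
    assert (E2 : forall n : nat, ex_series
      (phi21_term (qpow logq alpha) 0 (qpow logq (beta + INR n)) q x))
      by (intros; apply ex_series_phi21; auto).
    assert (Hnz : forall n k, qpoch (qpow logq beta) q n <> 0
      /\ qpoch (qpow logq beta * q ^ n) q k <> 0 /\ qpoch q q n <> 0 /\ qpoch q q k <> 0).
    { intros n k; repeat split; apply qpoch_neq_0; auto using admissible_shift. }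
    refine (conj H3 (conj E1 (conj _ (conj E2 _)))).
    (* No numerator factor of [Phi3] depends on [k], so both upper parameters of the inner series
       are 0. *)
    + apply (is_double_series_rows_scal _ _ _ _ E1) with (2 := H3).
      intros n k; unfold Phi3_term, phi21_term.
      rewrite !(qpow_add_INR q), !qpoch_add, qpoch_0_l by easy.
      pose proof (Hnz n k); field; tauto.
    + apply (is_double_series_rows_scal _ _ _ _ E2) with (2 := is_double_series_swap _ _ H3).
      intros k n; unfold Phi3_term, phi21_term.
      rewrite (PeanoNat.Nat.add_comm n k), !(qpow_add_INR q), !qpoch_add, qpoch_0_l by easy.
      pose proof (Hnz k n); field; tauto.
Qed.
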